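(* Let $X\sim \mathrm{mPH}(\boldsymbol{\pi},\mathcal{T})$ with $\mathcal{T}=\{\boldsymbol{T}_1,\dots,\boldsymbol{T}_d\}$. For $k=1,\dots,d$ let $$\sigma_k=\left(2\sum_{j=1}^p\pi_j\boldsymbol{e}_j^{\mathsf{T}}(-\boldsymbol{T}_k)^{-2}\boldsymbol{e}-\Big(\sum_{j=1}^p\pi_j\boldsymbol{e}_j^{\mathsf{T}}(-\boldsymbol{T}_k)^{-1}\boldsymbol{e}\Big)^2\right)^{1/2},$$ the standard deviation of $X_k$. Then for $k\ne l$, $k,l\in\{1,\dots,d\}$, the Pearson correlation of $X_k$ and $X_l$ is $$\rho_{X_k,X_l}=\frac{\sum_{j=1}^p\pi_j\,\boldsymbol{e}_j^{\mathsf{T}}(-\boldsymbol{T}_k)^{-1}\boldsymbol{e}\;\boldsymbol{e}_j^{\mathsf{T}}(-\boldsymbol{T}_l)^{-1}\boldsymbol{e}-\Big(\sum_{j=1}^p\pi_j\boldsymbol{e}_j^{\mathsf{T}}(-\boldsymbol{T}_k)^{-1}\boldsymbol{e}\Big)\Big(\sum_{j=1}^p\pi_j\boldsymbol{e}_j^{\mathsf{T}}(-\boldsymbol{T}_l)^{-1}\boldsymbol{e}\Big)}{\sigma_k\sigma_l}.$$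
   Context: Notation: $\boldsymbol{e}_j$ is the $j$-th canonical basis (column) vector of $\mathbb{R}^p$ and $\boldsymbol{e}=\sum_{j=1}^p\boldsymbol{e}_j$. mPH class. Let $\boldsymbol{\pi}=(\pi_1,\dots,\pi_p)$ be a probability row vector and let $\boldsymbol{T}_1,\dots,\boldsymbol{T}_d$ be real $p\times p$ sub-intensity matrices (nonnegative off-diagonal entries, strictly negative diagonal entries, nonpositive row sums) for which all states $1,\dots,p$ are transient (equivalently, each $\boldsymbol{T}_i$ is invertible). Let $\boldsymbol{t}_i=-\boldsymbol{T}_i\boldsymbol{e}$. For $i=1,\dots,d$ let $(J^{(i)}_t)_{t\ge 0}$ be a time-homogeneous Markov jump process on $\{1,\dots,p,p+1\}$ with $p+1$ absorbing, with transition intensities between the states $1,\dots,p$ given by $\boldsymbol{T}_i$ and intensities of jumping to $p+1$ given by $\boldsymbol{t}_i$. Assume that all the processes start in the same state, $J_0^{(1)}=\dots=J_0^{(d)}=:J_0$ with $\mathbb{P}(J_0=j)=\pi_j$ for $j=1,\dots,p$, and that the $d$ processes are conditionally independent given $J_0$. Put $X_i=\inf\{t>0: J^{(i)}_t=p+1\}$. Then $X=(X_1,\dots,X_d)$ is said to be mPH (multivariate phase-type) distributed, written $X\sim \mathrm{mPH}(\boldsymbol{\pi},\mathcal{T})$ with $\mathcal{T}=\{\boldsymbol{T}_1,\dots,\boldsymbol{T}_d\}$ (indexed by $i=1,\dots,d$). *)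

(* Defs.v *)
From HB Require Import structures.
From mathcomp Require Export all_boot all_order all_algebra.
From mathcomp Require Export all_classical all_reals all_analysis.
(* [all_analysis] does not export the measurable structure of \bar R. *)
From mathcomp Require Export measurable_realfun.

Set Implicit Arguments.
Unset Strict Implicit.
Unset Printing Implicit Defensive.

Export Order.TTheory GRing.Theory Num.Theory.
Export numFieldNormedType.Exports.

Local Open Scope classical_set_scope.
Local Open Scope ring_scope.

(* The states 1, ..., p and p+1 of the text are encoded in 'I_(p + 1): the
   non-absorbing states are [lshift 1 j] with j : 'I_p, the absorbing state
   p+1 is [absorbing]. *)
Definition absorbing {p : nat} : 'I_(p + 1) := rshift p ord0.

Definition is_probability_vector (R : realType) (p : nat) (pi : 'rV[R]_p) :=
  (forall j, 0 <= pi 0 j) /\ \sum_j pi 0 j = 1.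

Record is_sub_intensity (R : realType) (p : nat) (T : 'M[R]_p) : Prop := {
  sub_intensity_offdiag : forall i j, i != j -> 0 <= T i j ;
  sub_intensity_diag : forall i, T i i < 0 ;
  sub_intensity_row : forall i, \sum_j T i j <= 0 }.

Definition exit_rates (R : realType) (p : nat) (T : 'M[R]_p) : 'cV[R]_p :=
  - T *m const_mx 1.

Definition absorbing_intensity (R : realType) (p : nat) (T : 'M[R]_p) :
    'M[R]_(p + 1) :=
  block_mx T (exit_rates T) 0 0.

(* [Q t i j] is the probability to be in j at time s + t given state i at time
   s; the values of Q at negative times are irrelevant. *)
Record is_transition_function (R : realType) (n : nat)
    (Q : R -> 'M[R]_n) (L : 'M[R]_n) : Prop := {
  transition_ge0 : forall (t : R) i j, 0 <= t -> 0 <= Q t i j ;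
  transition_sum1 : forall (t : R) i, 0 <= t -> \sum_j Q t i j = 1 ;
  transition_0 : Q 0 = 1%:M ;
  transition_semigroup : forall s t : R, 0 <= s -> 0 <= t ->
    Q (s + t) = Q s *m Q t ;
  transition_intensity : forall i j,
    (fun h => (Q h i j - (i == j)%:R) / h) @ 0^'+ --> L i j }.

Definition is_jump_path (R : realType) (S : Type) (x : R -> S) :=
  (forall t : R, 0 <= t -> \forall s \near t^'+, x s = x t) /\
  (forall t : R, 0 < t -> exists a, \forall s \near t^'-, x s = a).

Section processes.
Context {R : realType} {d : measure_display} {Omega : measurableType d}.
Variable P : probability Omega R.

Definition cond_prob (A B : set Omega) : R := fine (P (A `&` B)) / fine (P B).

(* The sigma-algebra generated by the variables J_t, t in I. *)
Definition sigma_process (n : nat) (J : R -> Omega -> 'I_n) (I : set R) :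
    set (set Omega) :=
  <<s [set A | exists t s, I t /\ A = [set w | J t w = s]] >>.

Record is_markov_jump_process (n : nat) (J : R -> Omega -> 'I_n)
    (L : 'M[R]_n) : Prop := {
  mjp_measurable : forall (t : R) s, 0 <= t -> measurable [set w | J t w = s] ;
  mjp_path : forall w, is_jump_path (fun t => J t w) ;
  mjp_markov : exists2 Q : R -> 'M[R]_n, is_transition_function Q L &
    forall (t h : R) (A : set Omega) (i j : 'I_n), 0 <= t -> 0 <= h ->
      sigma_process J `[0, t] A ->
      (P (A `&` [set w | J t w = i]) != 0)%E ->
      cond_prob [set w | J (t + h) w = j] (A `&` [set w | J t w = i])
      = Q h i j }.

(* Taking some of the events A i equal to setT covers all subfamilies. *)
Definition cond_independent_processes (m n : nat)
    (J : 'I_m -> R -> Omega -> 'I_n) (J0 : Omega -> 'I_n) :=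
  forall s : 'I_n, (P [set w | J0 w = s] != 0)%E ->
  forall A : 'I_m -> set Omega,
    (forall i, sigma_process (J i) `[0, +oo[ (A i)) ->
    cond_prob (\bigcap_i A i) [set w | J0 w = s]
    = \prod_i cond_prob (A i) [set w | J0 w = s].

Definition standard_deviation (X : Omega -> R) : \bar R :=
  ('V_P[X] `^ 2^-1)%E.

Definition pearson_correlation (X Y : Omega -> R) : R :=
  fine (covariance P X Y)
  / (fine (standard_deviation X) * fine (standard_deviation Y)).

End processes.

Definition absorption_time (R : realType) (p : nat) (x : R -> 'I_(p + 1)) :
    \bar R :=
  ereal_inf [set t%:E | t in [set t | 0 < t /\ x t = absorbing]].

Record is_mPH_construction (R : realType) (m p : nat)
    (pi : 'rV[R]_p) (T : 'I_m -> 'M[R]_p)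
    (d : measure_display) (Omega : measurableType d) (P : probability Omega R)
    (J : 'I_m -> R -> Omega -> 'I_(p + 1)) (J0 : Omega -> 'I_(p + 1)) :
    Prop := {
  mPH_markov : forall i,
    is_markov_jump_process P (J i) (absorbing_intensity (T i)) ;
  mPH_start : forall i w, J i 0 w = J0 w ;
  mPH_initial : forall j : 'I_p,
    P [set w | J0 w = lshift 1 j] = (pi 0 j)%:E ;
  mPH_independent : cond_independent_processes P J J0 }.

(* X ~ mPH(pi, T) is a property of the law of X: the processes J may live on
   a probability space (Omega', P') different from the one carrying X. *)
Definition mPH (R : realType) (m p : nat)
    (d : measure_display) (Omega : measurableType d) (P : probability Omega R)
    (X : 'I_m -> {RV P >-> R}) (pi : 'rV[R]_p) (T : 'I_m -> 'M[R]_p) : Prop :=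
  [/\ is_probability_vector pi,
      (* invertibility says that the states 1, ..., p are transient *)
      forall i, is_sub_intensity (T i) /\ T i \in unitmx
    & exists (d' : measure_display) (Omega' : measurableType d')
        (P' : probability Omega' R)
        (J : 'I_m -> R -> Omega' -> 'I_(p + 1)) (J0 : Omega' -> 'I_(p + 1)),
      is_mPH_construction pi T P' J J0 /\
      forall B : set (m.-tuple (\bar R)), measurable B ->
        pushforward P (fun w => [tuple (X i w)%:E | i < m]) B =
        pushforward P'
          (fun w => [tuple absorption_time (fun t => J i t w) | i < m]) B].

(* [state_entry j M] is e_j^T M e. *)
Definition state_entry (R : realType) (p : nat) (j : 'I_p) (M : 'M[R]_p) : R :=
  (delta_mx (0 : 'I_1) j *m M *m (const_mx 1 : 'cV[R]_p)) 0 0.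

(* Main.v *)
(* The transition function Q of an absorbing process leaves the absorbing state
   fixed, so its transient block A is a substochastic semigroup with generator
   T. Up to null sets, {X_k > t} is the event that the k-th process is alive at
   t, and conditioning on J_0 = j gives
     P(X_k > t | J_0 = j) = S_j(t) = e_j^T A(t) e.
   Since A' = T A, the function T^-1 A e is an antiderivative of S, and the
   invertibility of T forces S to decay fast enough for the fundamental theorem
   of calculus on [0, +oo[ to give int S = (-T)^-1 e and
   int S(sqrt x) dx = 2 (-T)^-2 e, the conditional first and second moments.
   For k <> l, Tonelli gives E[X_k X_l] = int int P(X_k > s, X_l > t) ds dt, and
   conditional independence factors the integrand for each value of J_0. *)
Require Import Defs.
From mathcomp Require Import ring lra.

Set Implicit Arguments.
Unset Strict Implicit.
Unset Printing Implicit Defensive.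

Local Open Scope classical_set_scope.
Local Open Scope ring_scope.

(** * Substochastic semigroups *)

(** The defect [1 - \sum_j A t i j] stands for the probability of being absorbed by time [t]. This
    isolates what the analysis needs from the transient states. *)
Record is_substochastic_semigroup (R : realType) (p : nat)
    (A : R -> 'M[R]_p) (T : 'M[R]_p) : Prop := {
  substochastic_ge0 : forall (t : R) i j, 0 <= t -> 0 <= A t i j ;
  substochastic_le1 : forall (t : R) i, 0 <= t -> \sum_j A t i j <= 1 ;
  substochastic_0 : A 0 = 1%:M ;
  substochastic_semigroup : forall s t : R, 0 <= s -> 0 <= t ->
    A (s + t) = A s *m A t ;
  substochastic_generator : forall i j,
    (fun h => (A h i j - (i == j)%:R) / h) @ 0^'+ --> T i j }.

Section substochastic_semigroup.
Context {R : realType} {p : nat}.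
Variables (A : R -> 'M[R]_p) (T : 'M[R]_p).
Hypothesis HA : is_substochastic_semigroup A T.
Hypothesis T_unit : T \in unitmx.

Implicit Types (u : 'rV[R]_p) (t h x : R).

(** The row vector [u] is arbitrary, not only a probability vector: the family is then closed under
    time shift ([u *m A s]), differentiation ([u *m T]) and antidifferentiation ([u *m invmx T]). *)
Definition survival u t : R := (u *m A t *m (const_mx 1 : 'cV[R]_p)) 0 0.

Lemma survivalE u t :
  survival u t = \sum_i u 0 i * \sum_j A t i j.
Proof.
rewrite /survival -mulmxA mxE; apply: eq_bigr => i _; congr (_ * _).
by rewrite mxE; apply: eq_bigr => j _; rewrite mxE mulr1.
Qed.

Lemma survival0 u : survival u 0 = (u *m (const_mx 1 : 'cV[R]_p)) 0 0.
Proof. by rewrite /survival (substochastic_0 HA) mulmx1. Qed.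

Lemma survivalD u s t : 0 <= s -> 0 <= t ->
  survival u (s + t) = survival (u *m A s) t.
Proof.
by move=> s0 t0; rewrite /survival (substochastic_semigroup HA)// !mulmxA.
Qed.

Lemma row_sum_ge0 t i : 0 <= t -> 0 <= \sum_j A t i j.
Proof. by move=> t0; apply: sumr_ge0 => j _; exact: (substochastic_ge0 HA). Qed.

Lemma survival_ge0 u t : 0 <= t -> (forall i, 0 <= u 0 i) -> 0 <= survival u t.
Proof.
move=> t0 u0; rewrite survivalE; apply: sumr_ge0 => i _.
by rewrite mulr_ge0// row_sum_ge0.
Qed.

Lemma survival_le_norm u t : 0 <= t -> `|survival u t| <= \sum_i `|u 0 i|.
Proof.
move=> t0; rewrite survivalE (le_trans (ler_norm_sum _ _ _))//.
apply: ler_sum => i _; rewrite normrM ler_piMr//.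
rewrite ger0_norm ?(substochastic_le1 HA)//.
exact: row_sum_ge0.
Qed.

Lemma survival_nonincreasing u s t : 0 <= s -> s <= t ->
  (forall i, 0 <= u 0 i) -> survival u t <= survival u s.
Proof.
move=> s0 st u0; rewrite -(subrKC s t) survivalD ?subr_ge0//.
rewrite survivalE /survival [leRHS]mxE; apply: ler_sum => i _.
rewrite [X in _ <= _ * X]mxE mulr1.
apply: ler_piMr; last by rewrite (substochastic_le1 HA)// subr_ge0.
rewrite mxE; apply: sumr_ge0 => k _.
by rewrite mulr_ge0// (substochastic_ge0 HA).
Qed.

(** Letting the short time [h] act first separates the increment [A h - 1], controlled by the
    generator, from row sums at time [t], which lie between 0 and 1. *)
Lemma survivalB u t h : 0 <= t -> 0 <= h ->
  survival u (t + h) - survival u t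
  = \sum_i \sum_k u 0 i * (A h i k - (i == k)%:R) * \sum_j A t k j.
Proof.
move=> t0 h0; rewrite [t + h]addrC survivalD// !survivalE -sumrB exchange_big/=.
apply: eq_bigr => k _; rewrite -mulrBl -mulr_suml; congr (_ * _).
under [RHS]eq_bigr do rewrite mulrBr.
rewrite sumrB mxE; congr (_ - _); rewrite (bigD1 k)//= eqxx mulr1 big1 ?addr0//.
by move=> i /negPf ->; rewrite mulr0.
Qed.

Lemma semigroup_cvg0 i j : (fun h => A h i j - (i == j)%:R) @ 0^'+ --> 0.
Proof.
have : (A h i j - (i == j)%:R) / h * h @[h --> 0^'+] --> 0.
  rewrite -[X in _ --> X](mulr0 (T i j)).
  apply: cvgM; first exact: (substochastic_generator HA).
  exact: cvg_at_right_filter cvg_id.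
apply: cvg_trans; apply: near_eq_cvg; near=> h.
by rewrite divfK// gt_eqF//; near: h; exact: nbhs_right_gt.
Unshelve. all: by end_near. Qed.

(* Bounds the increment of [survival u] over any interval of length [h],
   uniformly in the position of the interval. *)
Let modulus u h := \sum_i \sum_k `|u 0 i * (A h i k - (i == k)%:R)|.

Lemma survivalB_modulus u t h : 0 <= t -> 0 <= h ->
  `|survival u (t + h) - survival u t| <= modulus u h.
Proof.
move=> t0 h0; rewrite survivalB// (le_trans (ler_norm_sum _ _ _))//.
apply: ler_sum => i _; rewrite (le_trans (ler_norm_sum _ _ _))//.
apply: ler_sum => k _; rewrite normrM ler_piMr//.
rewrite ger0_norm ?(substochastic_le1 HA)//.
exact: row_sum_ge0.
Qed.

Lemma modulus_cvg0 u : modulus u h @[h --> 0^'+] --> 0.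
Proof.
rewrite [X in _ --> X](_ : 0 = \sum_(i < p) \sum_(k < p) `|u 0 i * 0|).
  apply: cvg_big => [|i _]; first exact: add_continuous.
  apply: cvg_big => [|k _]; first exact: add_continuous.
  apply: cvg_norm; apply: cvgM; [exact: cvg_cst|exact: semigroup_cvg0].
by rewrite big1// => i _; rewrite big1// => k _; rewrite mulr0 normr0.
Qed.

Lemma survival_cvg_right0 u t : 0 <= t ->
  survival u (t + h) @[h --> 0^'+] --> survival u t.
Proof.
move=> t0; apply/cvgrPdist_le => e e0.
have /cvgr0Pnorm_le/(_ e e0) := @modulus_cvg0 u.
apply: filterS2 (nbhs_right_gt 0) => h h0; rewrite distrC => he.
rewrite (le_trans (survivalB_modulus _ _ (ltW h0)))//.
by rewrite (le_trans (ler_norm _)).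
Qed.

(** The modulus does not depend on where the interval lies, so it also applies to the interval from
    [t - h] to [t]. *)
Lemma survival_cvg_left0 u t : 0 < t ->
  survival u (t - h) @[h --> 0^'+] --> survival u t.
Proof.
move=> t0; apply/cvgrPdist_le => e e0.
have /cvgr0Pnorm_le/(_ e e0) := @modulus_cvg0 u.
apply: filterS3 (nbhs_right_gt 0) (nbhs_right_le t0) => h h0 ht he.
rewrite -{1}(subrK h t) (le_trans (survivalB_modulus _ _ (ltW h0)))//.
  by rewrite subr_ge0.
by rewrite (le_trans (ler_norm _)).
Qed.

Lemma row_sum k t : survival (delta_mx 0 k) t = \sum_j A t k j.
Proof.
rewrite survivalE (bigD1 k)//= mxE !eqxx mul1r [X in _ + X]big1 ?addr0//.
by move=> i /negPf ik; rewrite mxE ik andbF mul0r.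
Qed.

(** The factor [f] is left free to treat both one-sided derivatives: row sums are taken at [t] for
    the right one and at [t - h] for the left one. *)
Lemma survival_right_derivative u t (f : 'I_p -> R -> R) : 0 <= t ->
  (forall k, f k h @[h --> 0^'+] --> \sum_j A t k j) ->
  \sum_i \sum_k u 0 i * ((A h i k - (i == k)%:R) / h) * f k h @[h --> 0^'+]
  --> survival (u *m T) t.
Proof.
move=> t0 cf.
have -> : survival (u *m T) t
    = \sum_i \sum_k u 0 i * T i k * \sum_j A t k j.
  rewrite survivalE exchange_big; apply: eq_bigr => k _.
  by rewrite mxE mulr_suml.
apply: cvg_big => [|i _]; first exact: add_continuous.
apply: cvg_big => [|k _]; first exact: add_continuous.
apply: cvgM; last exact: cf.
by apply: cvgM; [exact: cvg_cst|exact: (substochastic_generator HA)].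
Qed.

Lemma is_derive_survival u t : 0 < t ->
  is_derive t 1 (survival u) (survival (u *m T) t).
Proof.
move=> t0.
have lim : (fun h => h^-1 *: ((survival u \o shift t) (h *: 1) - survival u t))
    @ 0^' --> survival (u *m T) t.
  apply: (@cvg_at_right_left_dnbhs _ R^o).
    have right k : \sum_j A t k j @[_ --> (0 : R)^'+] --> \sum_j A t k j.
      exact: cvg_cst.
    have := @survival_right_derivative u t _ (ltW t0) right.
    apply: cvg_trans; apply: near_eq_cvg; near=> h.
    have h0 : 0 < h by near: h; exact: nbhs_right_gt.
    rewrite /= [h *: 1]mulr1 [h + t]addrC survivalB ?ltW//.
    rewrite scaler_sumr; apply: eq_bigr => i _.
    rewrite scaler_sumr; apply: eq_bigr => k _.
    by rewrite /GRing.scale/=; ring.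
  (* The left quotient is an increment starting at [t - h], so its row sums move with [h]; left
     continuity gives their limit. *)
  apply/cvg_at_leftNP; rewrite oppr0.
  have left k : \sum_j A (t - h) k j @[h --> 0^'+] --> \sum_j A t k j.
    under eq_fun do rewrite -row_sum.
    by rewrite -row_sum; exact: survival_cvg_left0.
  have := @survival_right_derivative u t _ (ltW t0) left.
  apply: cvg_trans; apply: near_eq_cvg; near=> h.
  have h0 : 0 < h by near: h; exact: nbhs_right_gt.
  have ht : h <= t by near: h; exact: nbhs_right_le.
  rewrite /= [_ *: 1]mulr1 [- h + t]addrC.
  rewrite -[in survival u t](subrK h t) -[_ - survival u _]opprB.
  rewrite survivalB ?subr_ge0 ?ltW// invrN scalerN scaleNr opprK.
  rewrite scaler_sumr; apply: eq_bigr => i _.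
  rewrite scaler_sumr; apply: eq_bigr => k _.
  by rewrite /GRing.scale/=; ring.
apply: DeriveDef; first by apply/cvg_ex; exists (survival (u *m T) t).
exact: cvg_lim lim.
Unshelve. all: by end_near. Qed.

Lemma continuous_survival u : {within `[0, +oo[, continuous (survival u)}.
Proof.
apply/continuous_within_itvcyP; split.
  move=> x; rewrite in_itv/= andbT => x0.
  apply/differentiable_continuous/derivable1_diffP.
  by case: (is_derive_survival u x0).
apply/cvgrPdist_le => e e0; rewrite nbhs_right0P.
move: e e0; apply/cvgrPdist_le.
exact: survival_cvg_right0.
Qed.

Lemma is_derive_survival_inv u t : 0 < t ->
  is_derive t 1 (survival (u *m invmx T)) (survival u t).
Proof. by move=> /(is_derive_survival (u *m invmx T)); rewrite mulmxKV. Qed.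

(** By the mean value theorem, [x * survival u c] is, for some [c] before [x], an increment of the
    bounded antiderivative [survival (u *m invmx T)]; monotonicity replaces [c] by [x]. *)
Lemma survival_decay u x : 0 < x -> (forall i, 0 <= u 0 i) ->
  x * survival u x <= 2 * \sum_i `|(u *m invmx T) 0 i|.
Proof.
move=> x0 u0.
have [||c] := @MVT R (survival (u *m invmx T)) (survival u) 0 x x0.
- by move=> y; rewrite in_itv/= => /andP[y0 _]; exact: is_derive_survival_inv.
- apply: (@continuous_subspaceW R^o _ _ [set` `[0, +oo[%R]).
    exact: subset_itvl.
  exact: continuous_survival.
rewrite in_itv/= subr0 => /andP[c0 cx] mvt.
rewrite (@le_trans _ _ (survival u c * x))//.
  rewrite mulrC ler_wpM2r ?(ltW x0)//.
  by apply: survival_nonincreasing => //; exact: ltW.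
rewrite -mvt (le_trans (ler_norm _))// (le_trans (ler_normB _ _))//.
by rewrite mulr_natl mulr2n lerD// survival_le_norm// ltW.
Qed.

(* Splitting the interval at its midpoint squares the rate of decay. *)
Lemma survival_quadratic_decay u : exists K, forall x, 0 < x ->
  `|survival u x| <= K / x ^+ 2.
Proof.
pose v : 'rV[R]_p := map_mx Num.norm u.
have v0 i : 0 <= v 0 i by rewrite mxE.
(* [C] adds the constants of [survival_decay] over all starting states, so that it serves for
   whichever state is occupied at the midpoint. *)
pose C := \sum_k (2 * \sum_i `|(delta_mx 0 k *m invmx T : 'rV[R]_p) 0 i|).
have C_ge k : 2 * \sum_i `|(delta_mx 0 k *m invmx T : 'rV[R]_p) 0 i| <= C.
  rewrite /C [leRHS](bigD1 k)//= lerDl; apply: sumr_ge0 => i _.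
  by rewrite mulr_ge0// sumr_ge0.
have C0 : 0 <= C by apply: sumr_ge0 => i _; rewrite mulr_ge0// sumr_ge0.
pose D := 2 * \sum_i `|(v *m invmx T) 0 i|.
exists (4 * (C * D)) => x x0.
have uv : `|survival u x| <= survival v x.
  rewrite !survivalE (le_trans (ler_norm_sum _ _ _))//.
  apply: ler_sum => i _; rewrite normrM mxE [`|\sum_j _|]ger0_norm//.
  by rewrite row_sum_ge0// ltW.
rewrite (le_trans uv)// ler_pdivlMr ?exprn_gt0//.
pose y := x / 2; have y0 : 0 < y by rewrite divr_gt0.
have y0' := ltW y0.
have -> : x = y + y by rewrite /y -splitr.
have -> : survival v (y + y) * (y + y) ^+ 2
    = 4 * (y * (y * survival v (y + y))).
  by ring.
rewrite ler_wpM2l//.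
have vy k : 0 <= (v *m A y) 0 k.
  by rewrite mxE sumr_ge0// => i _; rewrite mulr_ge0// (substochastic_ge0 HA).
rewrite survivalD// survivalE.
rewrite (@le_trans _ _ (y * \sum_k (v *m A y) 0 k * C))//.
  rewrite ler_wpM2l// mulr_sumr; apply: ler_sum => k _.
  rewrite mulrCA ler_wpM2l// (le_trans _ (C_ge k))//.
  rewrite -row_sum survival_decay// => i.
  by rewrite mxE.
rewrite -mulr_suml mulrA [leLHS]mulrC ler_wpM2l//.
have -> : \sum_k (v *m A y) 0 k = survival v y.
  rewrite /survival [RHS]mxE; apply: eq_bigr => k _.
  by rewrite [X in _ = _ * X]mxE mulr1.
exact: survival_decay.
Qed.

(** This is the boundary term at infinity in the integration by parts for the second moment; the
    linear decay alone would only show it bounded. *)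
Lemma survival_id_cvgy u : x * survival u x @[x --> +oo] --> 0.
Proof.
have [K HK] := survival_quadratic_decay u.
apply/cvgr0Pnorm_le => e e0; near=> x.
have x0 : 0 < x by near: x; apply: nbhs_pinfty_gt; rewrite num_real.
have Kx : K / e <= x by near: x; apply: nbhs_pinfty_ge; rewrite num_real.
rewrite normrM gtr0_norm// (le_trans (ler_wpM2l (ltW x0) (HK _ x0)))//.
have -> : x * (K / x ^+ 2) = K / x by field; rewrite gt_eqF.
by rewrite ler_pdivrMr// mulrC -ler_pdivrMr.
Unshelve. all: by end_near. Qed.

Lemma survival_cvgy u : survival u x @[x --> +oo] --> 0.
Proof.
apply/cvgr0Pnorm_le => e e0.
have /cvgr0Pnorm_le/(_ e e0) := survival_id_cvgy u.
apply: filterS2 (nbhs_pinfty_ge (num_real 1)) => x x1.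
apply: le_trans; rewrite normrM ler_peMl//.
by rewrite ger0_norm// (le_trans ler01).
Qed.

Lemma invmxN : invmx (- T) = - invmx T.
Proof. rewrite -scaleN1r invmxZ; first by rewrite invrN1 scaleN1r.
by rewrite unitmxZ ?unitrN1. Qed.

Local Open Scope ereal_scope.
Local Notation mu := lebesgue_measure.

(** The antiderivative [survival (u *m invmx T)] vanishes at infinity, so the integral is minus its
    value at 0; the sign turns [T] into [- T]. *)
Lemma integral_survival u : (forall i, 0 <= u 0 i)%R ->
  \int[mu]_(x in `[0%R, +oo[) (survival u x)%:E
  = ((u *m invmx (- T) *m (const_mx 1 : 'cV[R]_p)) 0 0)%R%:E.
Proof.
move=> u0.
rewrite (@ge0_continuous_FTC2y _ _ (survival (u *m invmx T)) _ 0%R).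
- by rewrite survival0 invmxN mulmxN mulNmx [in RHS]mxE add0e EFinN.
- by move=> x x0; exact: survival_ge0.
- exact: continuous_survival.
- exact: survival_cvgy.
- by move=> x x0; case: (is_derive_survival_inv u x0).
- by have /continuous_within_itvcyP[] := @continuous_survival (u *m invmx T).
- move=> x; rewrite in_itv/= andbT => x0; rewrite derive1E.
  by case: (is_derive_survival_inv u x0).
Qed.

Lemma cvgy_sqrt : (Num.sqrt x @[x --> +oo] --> (+oo : set_system R))%R.
Proof.
apply/cvgryPge => a; near=> x.
apply: (le_trans (ler_norm a)); rewrite -sqrtr_sqr; apply: ler_wsqrtr.
by near: x; apply: nbhs_pinfty_ge; rewrite num_real.
Unshelve. all: by end_near. Qed.

(* If P(X > t) = survival u t then P(X^2 > x) = survival u (sqrt x), so this is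
   the second moment of X. *)
Lemma integral_survival_sqrt u : (forall i, 0 <= u 0 i)%R ->
  \int[mu]_(x in `[0%R, +oo[) (survival u (Num.sqrt x))%:E
  = (2 * (u *m (invmx (- T) *m invmx (- T)) *m
          (const_mx 1 : 'cV[R]_p)) 0 0)%R%:E.
Proof.
move=> u0.
pose W := invmx T.
(* Integration by parts gives [G] as an antiderivative of [2 * (t * survival u t)]. Composed with
   [Num.sqrt], whose derivative is the inverse of [2 * Num.sqrt x], it becomes an antiderivative of
   the integrand. *)
pose G x : R :=
  (2 * (x * survival (u *m W) x) - 2 * survival (u *m W *m W) x)%R.
have dG t : (0 < t)%R -> is_derive t 1%R G (2 * (t * survival u t))%R.
  move=> t0.
  have d1 := is_derive_survival_inv u t0.
  have d2 := is_derive_survival_inv (u *m W) t0.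
  apply: is_derive_eq.
  rewrite /GRing.scale/=; ring.
have cG : G x @[x --> 0^'+] --> G 0%R.
  have c v : survival v x @[x --> 0^'+] --> survival v 0%R.
    by have /continuous_within_itvcyP[] := @continuous_survival v.
  apply: cvgB; apply: cvgM; [exact: cvg_cst| |exact: cvg_cst|exact: c].
  by apply: cvgM; [exact: cvg_at_right_filter cvg_id|exact: c].
have cs : (Num.sqrt x @[x --> 0^'+] --> (0^'+ : set_system R))%R.
  move=> P [e /= e0 He].
  suff : \forall x \near (0 : R)%R^'+, P (Num.sqrt x) by [].
  near=> x; have x0 : (0 < x)%R by near: x; exact: nbhs_right_gt.
  apply: He; rewrite /= ?sqrtr_gt0// sub0r normrN ger0_norm ?sqrtr_ge0//.
  rewrite -(gtr0_norm e0) -sqrtr_sqr ltr_sqrt ?exprn_gt0//.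
  by near: x; apply: nbhs_right_lt; rewrite exprn_gt0.
rewrite (@ge0_continuous_FTC2y _ _ (G \o Num.sqrt) _ 0%R).
- rewrite /= sqrtr0 /G mul0r mulr0 !sub0r survival0 add0e opprK.
  by rewrite invmxN mulmxN mulNmx opprK mulmxA.
- by move=> x x0; exact: survival_ge0.
- apply/continuous_within_itvcyP; split.
    move=> x; rewrite in_itv/= andbT => x0.
    apply: continuous_comp; first exact: sqrt_continuous.
    have /continuous_within_itvcyP[+ _] := @continuous_survival u.
    by apply; rewrite in_itv/= andbT sqrtr_gt0.
  rewrite sqrtr0.
  apply: (cvg_comp _ _ cs).
  by have /continuous_within_itvcyP[] := @continuous_survival u.
- apply: (cvg_comp _ _ cvgy_sqrt).
  suff : G x @[x --> +oo%R] --> (2 * 0 - 2 * 0 : R)%R by rewrite mulr0 subr0.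
  apply: cvgB; apply: cvgM; try exact: cvg_cst.
    exact: survival_id_cvgy.
  exact: survival_cvgy.
- move=> x x0; have s0 : (0 < Num.sqrt x)%R by rewrite sqrtr_gt0.
  by case: (is_derive1_comp (dG _ s0) (is_derive1_sqrt x0)).
- rewrite /= sqrtr0; exact: (cvg_comp _ _ cs).
- move=> x; rewrite in_itv/= andbT => x0; rewrite derive1E.
  have s0 : (0 < Num.sqrt x)%R by rewrite sqrtr_gt0.
  case: (is_derive1_comp (dG _ s0) (is_derive1_sqrt x0)) => _ ->.
  by rewrite mulrA mulrAC divff ?mul1r// mulf_neq0// gt_eqF.
Unshelve. all: by end_near. Qed.

End substochastic_semigroup.

(** * Transition functions with an absorbing state *)

Section transition_function.
Context {R : realType} {p : nat}.
Variables (T : 'M[R]_p) (Q : R -> 'M[R]_(p + 1)).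
Hypothesis HQ : is_transition_function Q (absorbing_intensity T).

Lemma transition_le1 (t : R) i j : 0 <= t -> Q t i j <= 1.
Proof.
move=> t0; rewrite -(transition_sum1 HQ i t0) (bigD1 j)//= lerDl.
by apply: sumr_ge0 => k _; exact: (transition_ge0 HQ).
Qed.

(* [1 - Q t i i] is subadditive in t; for the absorbing state it has derivative
   0 at 0, hence vanishes. *)
Lemma transition_leave_subadditive (s t : R) i : 0 <= s -> 0 <= t ->
  1 - Q (s + t) i i <= (1 - Q s i i) + (1 - Q t i i).
Proof.
move=> s0 t0.
have : Q s i i * Q t i i <= Q (s + t) i i.
  rewrite (transition_semigroup HQ)// mxE (bigD1 i)//= lerDl.
  by apply: sumr_ge0 => k _; rewrite mulr_ge0// (transition_ge0 HQ).
have := transition_le1 i i s0; have := transition_le1 i i t0.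
have := transition_ge0 HQ i i s0; have := transition_ge0 HQ i i t0.
nra.
Qed.

Lemma transition_leaveMn (t : R) i n : 0 <= t ->
  1 - Q (n%:R * t) i i <= n%:R * (1 - Q t i i).
Proof.
move=> t0; elim: n => [|n IH].
  by rewrite !mul0r (transition_0 HQ) mxE eqxx subrr.
rewrite -natr1 !mulrDl !mul1r.
rewrite (le_trans (transition_leave_subadditive i _ t0)) ?lerD2r//.
by rewrite mulr_ge0.
Qed.

Lemma transition_absorbing (t : R) : 0 <= t -> Q t absorbing absorbing = 1.
Proof.
move=> t0; apply/eqP; rewrite eq_le transition_le1//= -subr_le0.
apply/ler_addgt0Pr => e e0; rewrite add0r.
(* With this tolerance on the rate, [n] pieces of length [t / n] lose at most [e * (t / (t + 1))],
   which is at most [e]; the summand 1 covers [t = 0]. *)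
have d0 : 0 < e / (t + 1) by rewrite divr_gt0// ltr_wpDl.
have := @transition_intensity _ _ _ _ HQ absorbing absorbing.
rewrite /absorbing_intensity block_mxEdr mxE eqxx.
move=> /cvgr0Pnorm_le/(_ _ d0); rewrite near_withinE => -[r /= r0 Hr].
have [n n0 tn] : exists2 n : nat, (0 < n)%N & t / n%:R < r.
  exists (Num.truncn (t / r)).+1 => //.
  by rewrite ltr_pdivrMr// mulrC -ltr_pdivrMr// truncnS_gt.
have n0' : 0 < n%:R :> R by rewrite ltr0n.
have [->|tN0] := eqVneq t 0.
  by rewrite (transition_0 HQ) mxE eqxx subrr ltW.
have tn0 : 0 < t / n%:R by rewrite divr_gt0// lt0r tN0.
have -> : t = n%:R * (t / n%:R) by rewrite mulrC divfK// gt_eqF.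
rewrite (le_trans (transition_leaveMn _ _ (ltW tn0)))//.
have : ball_ [eta Num.norm] 0 r (t / n%:R).
  by rewrite /= sub0r normrN gtr0_norm.
move=> /Hr/(_ tn0).
rewrite normrM normfV (gtr0_norm tn0) ler_pdivrMr// => H.
have {H} : 1 - Q (t / n%:R) absorbing absorbing <= e / (t + 1) * (t / n%:R).
  by rewrite (le_trans _ H)// distrC ler_norm.
move=> /(ler_wpM2l (ltW n0'))/le_trans; apply.
have -> : n%:R * (e / (t + 1) * (t / n%:R)) = e * (t / (t + 1)).
  by field; rewrite !gt_eqF// ltr_wpDl.
rewrite ler_piMr ?(ltW e0)// ler_pdivrMr ?ltr_wpDl// mul1r.
by rewrite lerDl.
Qed.

Lemma transition_absorbingN (t : R) i : 0 <= t ->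
  Q t absorbing (lshift 1 i) = 0.
Proof.
move=> t0; apply/eqP; rewrite eq_le (transition_ge0 HQ)// andbT.
have := transition_sum1 HQ absorbing t0.
rewrite big_split_ord/= big_ord1 [X in _ + Q _ _ X](_ : _ = absorbing)//.
rewrite transition_absorbing// => /eqP.
rewrite addrC -subr_eq0 addrAC subrr add0r (bigD1 i)//= => /eqP <-.
rewrite lerDl; apply: sumr_ge0 => k _; exact: (transition_ge0 HQ).
Qed.

Definition transient_block (t : R) : 'M[R]_p := ulsubmx (Q t).

Lemma transient_blockE t i j :
  transient_block t i j = Q t (lshift 1 i) (lshift 1 j).
Proof. by rewrite !mxE. Qed.

Lemma transient_block_sum t i : 0 <= t ->
  \sum_j transient_block t i j = 1 - Q t (lshift 1 i) absorbing.
Proof.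
move=> t0; rewrite -(transition_sum1 HQ (lshift 1 i) t0).
rewrite big_split_ord/= big_ord1 addrK.
by apply: eq_bigr => j _; rewrite transient_blockE.
Qed.

Lemma transient_block_ge0 t i j : 0 <= t -> 0 <= transient_block t i j.
Proof. by move=> t0; rewrite transient_blockE (transition_ge0 HQ). Qed.

Lemma transient_block_le1 t i : 0 <= t -> \sum_j transient_block t i j <= 1.
Proof.
move=> t0; rewrite transient_block_sum// lerBlDr lerDl.
exact: (transition_ge0 HQ).
Qed.

Lemma transient_block0 : transient_block 0 = 1%:M.
Proof.
by apply/matrixP => i j; rewrite transient_blockE (transition_0 HQ) !mxE.
Qed.

(** The intermediate state [absorbing] contributes nothing to the product, since no transient state
    is reached from it. *)
Lemma transient_blockD s t : 0 <= s -> 0 <= t ->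
  transient_block (s + t) = transient_block s *m transient_block t.
Proof.
move=> s0 t0; apply/matrixP => i j.
rewrite transient_blockE (transition_semigroup HQ)// !mxE big_split_ord/=.
rewrite big_ord1 [X in _ + _ * Q _ X _](_ : _ = absorbing)//.
rewrite transition_absorbingN// mulr0 addr0.
by apply: eq_bigr => k _; rewrite !transient_blockE.
Qed.

Lemma transient_block_intensity i j :
  (fun h => (transient_block h i j - (i == j)%:R) / h) @ 0^'+ --> T i j.
Proof.
have := @transition_intensity _ _ _ _ HQ (lshift 1 i) (lshift 1 j).
rewrite /absorbing_intensity block_mxEul (inj_eq (@lshift_inj _ _)).
by under [in X in _ -> X]eq_fun do rewrite transient_blockE.
Qed.

Lemma transient_block_semigroup :
  is_substochastic_semigroup transient_block T.
Proof.
split.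
- exact: transient_block_ge0.
- exact: transient_block_le1.
- exact: transient_block0.
- exact: transient_blockD.
- exact: transient_block_intensity.
Qed.

End transition_function.

(** * Absorption times *)

(** Integers that encode no rational are sent to 0, which merely repeats a value of the
    enumeration. *)
Definition rat_enum (R : realType) (n : nat) : R :=
  ratr (odflt 0 (unpickle n : option rat)).

Lemma rat_enum_in_itvoo (R : realType) (a b : R) : a < b ->
  exists n, a < rat_enum R n < b.
Proof.
move=> /rat_in_itvoo[q]; rewrite in_itv/= => qab; exists (pickle q).
by rewrite /rat_enum pickleK.
Qed.

(* By right-continuity, a visit of the absorbing state before t persists until
   some rational time, so countably many times suffice. *)
Lemma absorption_time_leP (R : realType) (p : nat) (x : R -> 'I_(p + 1))
    (t : R) : is_jump_path x -> 0 <= t ->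
  (absorption_time x <= t%:E)%E <->
  x t = absorbing \/
  exists n, 0 < rat_enum R n < t /\ x (rat_enum R n) = absorbing.
Proof.
move=> [rx _] t0; split; last first.
  case=> [xt|[n [/andP[n0 nt] xn]]]; last first.
    rewrite (@le_trans _ _ (rat_enum R n)%:E) ?lee_fin ?(ltW nt)//.
    by apply: ereal_inf_lbound; exists (rat_enum R n).
  (* The time [t] may be 0, which the infimum excludes; right-continuity supplies absorbed times
     just after [t]. *)
  apply/lee_addgt0Pr => e e0.
  have [s [ts se xs]] : exists s, [/\ t < s, s < t + e & x s = x t].
    near t^'+ => s; exists s; split.
    - by near: s; exact: nbhs_right_gt.
    - by near: s; apply: nbhs_right_lt; rewrite ltrDl.
    - by near: s; exact: rx.
  rewrite (@le_trans _ _ s%:E) ?lee_fin ?(ltW se)//.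
  apply: ereal_inf_lbound; exists s => //; split; last by rewrite xs.
  exact: le_lt_trans ts.
move=> tau_le; apply: contrapT => /not_orP[xt noq].
have early s : 0 < s -> s < t -> x s != absorbing.
  move=> s0 st; apply/eqP => xs; apply: noq.
  have := rx s (ltW s0); rewrite near_withinE => -[r /= r0 Hr].
  have : s < Num.min t (s + r) by rewrite lt_min st ltrDl.
  move=> /rat_enum_in_itvoo[n /andP[sn]]; rewrite lt_min => /andP[nt nr].
  exists n; split; first by rewrite nt (lt_trans s0).
  by rewrite Hr// /ball/= distrC ger0_norm ?subr_ge0 ?(ltW sn)// ltrBlDl.
(* Without a visit up to [t], right-continuity at [t] postpones absorption to [t + r] at least, a
   contradiction. *)
have := rx t t0; rewrite near_withinE => -[r /= r0 Hr].
have : ((t + r)%:E <= absorption_time x)%E.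
  apply/ereal_infP => _ [s [s0 xs] <-]; rewrite lee_fin leNgt.
  apply/negP => str.
  have [st|ts|st] := ltgtP s t.
  - by move: (early s s0 st); rewrite xs eqxx.
  - apply: xt; rewrite -xs; apply/esym/Hr => //.
    by rewrite /= distrC gtr0_norm ?subr_gt0// ltrBlDl.
  - by apply: xt; rewrite -st.
by move=> /le_trans/(_ tau_le); rewrite lee_fin gerDl leNgt r0.
Unshelve. all: by end_near. Qed.

Lemma absorption_time_ge0 (R : realType) (p : nat) (x : R -> 'I_(p + 1)) :
  (0 <= absorption_time x)%E.
Proof.
by apply/ereal_infP => _ [s [s0 _] <-]; rewrite lee_fin ltW.
Qed.

Lemma sigma_process_setT (R : realType) d (Omega : measurableType d) n
  (J : R -> Omega -> 'I_n) I : sigma_process J I setT.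
Proof. 
rewrite /sigma_process -[X in _ X]setC0; apply: (@sigma_algebraC Omega).
exact: sigma_algebra0.
Qed.

Section absorbing_process.
Context {R : realType} {d : measure_display} {Omega : measurableType d}.
Variables (P : probability Omega R) (p : nat) (T : 'M[R]_p).
Variable J : R -> Omega -> 'I_(p + 1).
Hypothesis HJ : is_markov_jump_process P J (absorbing_intensity T).

(** Absorption is encoded by the intensities, not by the paths. It is permanent almost surely by the
    Markov property with trivial past, as [Q (t - s) absorbing absorbing] is 1. *)
Lemma absorbing_ae (s t : R) : 0 <= s -> s <= t ->
  P ([set w | J s w = absorbing] `\` [set w | J t w = absorbing]) = 0%E.
Proof.
move=> s0 st; have t0 := le_trans s0 st.
have mA : measurable [set w | J s w = absorbing] by exact: (mjp_measurable HJ).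
have mB : measurable [set w | J t w = absorbing] by exact: (mjp_measurable HJ).
have [PA0|PA0] := eqVneq (P [set w | J s w = absorbing]) 0%E.
  by apply: subset_measure0 PA0 => //; exact: measurableD.
have [Q HQ Hcond] := mjp_markov HJ.
have sT := @sigma_process_setT R d Omega _ J `[0, s].
have := Hcond s (t - s) setT absorbing absorbing s0.
rewrite subr_ge0 subrKC setTI => /(_ st sT PA0).
rewrite (transition_absorbing HQ) ?subr_ge0// /cond_prob => H.
have fPA : P [set w | J s w = absorbing] \is a fin_num.
  by rewrite fin_num_measure.
have fPA0 : fine (P [set w | J s w = absorbing]) != 0 by rewrite fine_eq0.
move: H => /(congr1 (fun r => r * fine (P [set w | J s w = absorbing]))).
rewrite divfK// mul1r => /eqP; rewrite -eqe !fineK ?fin_num_measure//.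
  move=> /eqP PAB; apply/eqP; rewrite measureD// ?ltry//.
    rewrite [X in (_ - X)%E](_ : _ = P [set w | J s w = absorbing]) ?subee//.
    by rewrite setIC; exact: PAB.
  by rewrite -ge0_fin_numE.
exact: measurableI.
Qed.

Let late t w := (t%:E < absorption_time (fun s => J s w))%E.

Lemma lateE t : 0 <= t -> [set w | late t w] =
  ~` ([set w | J t w = absorbing] `|`
      \bigcup_n (if 0 < rat_enum R n < t
                 then [set w | J (rat_enum R n) w = absorbing] else set0)).
Proof.
move=> t0; apply/seteqP; split => w /=; rewrite /late ltNge.
  move=> /negP; apply: contra_not => H.
  apply/(absorption_time_leP (mjp_path HJ w) t0).
  case: H => [->|[n _]]; first by left.
  by case: ifPn => // nt Hn; right; exists n.
move=> H; apply/negP => /(absorption_time_leP (mjp_path HJ w) t0) H'; apply: H.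
case: H' => [->|[n [nt Hn]]]; first by left.
by right; exists n => //; rewrite nt.
Qed.

Lemma measurable_absorption_time_gt t : 0 <= t ->
  measurable [set w | (t%:E < absorption_time (fun s => J s w))%E].
Proof.
move=> t0; rewrite lateE//; apply: measurableC; apply: measurableU.
  exact: (mjp_measurable HJ).
apply: bigcupT_measurable => n; case: ifPn => // /andP[n0 _].
by apply: (mjp_measurable HJ); exact: ltW.
Qed.

(** A path absorbed by time [t] but not absorbing at [t] has left [absorbing] after some rational
    time; these are countably many null events. *)
Lemma absorption_time_gt_negligible t : 0 <= t ->
  P.-negligible ([set w | J t w != absorbing] `\`
                 [set w | (t%:E < absorption_time (fun s => J s w))%E]).
Proof.
move=> t0; apply: (@negligibleS _ _ _ _ (\bigcup_n (if 0 < rat_enum R n < t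
   then [set w | J (rat_enum R n) w = absorbing] `\` [set w | J t w = absorbing]
   else set0))).
  move=> w [/= /eqP Jt]; rewrite -[X in ~ X]/([set w | late t w] w) lateE//=.
  move=> /contrapT[//|[n _ Hn]]; exists n => //.
  by move: Hn; case: ifPn => // _ Jn; split.
apply: negligible_bigcup => n; case: ifPn => [/andP[n0 nt]|_]; last first.
  exact: negligible_set0.
apply/negligibleP; last by apply: absorbing_ae; exact: ltW.
by apply: measurableD; apply: (mjp_measurable HJ) => //; exact: ltW.
Qed.

Lemma absorption_time_gt_sub t : 0 <= t ->
  [set w | (t%:E < absorption_time (fun s => J s w))%E] `<=`
  [set w | J t w != absorbing].
Proof.
move=> t0 w; rewrite -[X in X -> _]/([set w | late t w] w) lateE//= => H.
by apply/eqP => Jt; apply: H; left.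
Qed.

Lemma measurable_neq_absorbing t : 0 <= t ->
  measurable [set w | J t w != absorbing].
Proof.
move=> t0; rewrite [X in measurable X](_ : _ = ~` [set w | J t w = absorbing]).
  by apply: measurableC; exact: (mjp_measurable HJ).
by apply/seteqP; split => w /= /eqP.
Qed.

End absorbing_process.

(** * Conditioning on the initial state *)

Section total_probability.
Context {R : realType} {d : measure_display} {Omega : measurableType d}.
Variables (P : probability Omega R) (p : nat) (pi : 'rV[R]_p).
Variable J0 : Omega -> 'I_(p + 1).
Hypothesis mJ0 : forall s, measurable [set w | J0 w = s].
Hypothesis pi_prob : is_probability_vector pi.
Hypothesis initial : forall j : 'I_p,
  P [set w | J0 w = lshift 1 j] = (pi 0 j)%:E.

Lemma initial_decomposition (E : set Omega) : measurable E ->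
  P E = (\sum_s P (E `&` [set w | J0 w = s]))%E.
Proof.
move=> mE; rewrite -measure_bigsetU_ord.
- congr (P _); rewrite -bigcup_seq; apply/seteqP; split => [w Ew|w [s _ []//]].
  by exists (J0 w) => //=; rewrite mem_index_enum.
- by move=> s; exact: measurableI.
- by move=> s s' _ _ [w [[_ <-] [_ <-]]].
Qed.

(** The transient states already carry the total mass 1 of [pi]. *)
Lemma initial_absorbing : P [set w | J0 w = absorbing] = 0%E.
Proof.
have := initial_decomposition measurableT.
rewrite probability_setT; under eq_bigr do rewrite setTI.
rewrite big_split_ord/= big_ord1 (eq_bigr _ (fun j _ => initial j)).
rewrite sumEFin (proj2 pi_prob).
rewrite [X in [set w | J0 w = X]](_ : _ = absorbing)//.
rewrite -(fineK (fin_num_measure P _ (mJ0 absorbing))) => /(congr1 fine)/= H.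
congr EFin; lra.
Qed.

Lemma total_probability (E : set Omega) : measurable E ->
  P E = (\sum_j pi 0 j * cond_prob P E [set w | J0 w = lshift 1 j])%:E.
Proof.
move=> mE; rewrite initial_decomposition// big_split_ord/= big_ord1.
rewrite [X in (_ + X)%E](_ : _ = 0%E) ?adde0; last first.
  apply: subset_measure0 initial_absorbing => //; exact: measurableI.
rewrite -sumEFin; apply: eq_bigr => j _.
rewrite /cond_prob initial/=.
(* If [pi 0 j] is 0, [cond_prob] divides by 0, but its weight and the probability on the left both
   vanish. *)
have [pj0|pj0] := eqVneq (pi 0 j) 0; last first.
  by rewrite mulrC divfK// fineK// fin_num_measure//; exact: measurableI.
rewrite pj0 mul0r.
apply: (@subset_measure0 _ _ _ _ _ [set w | J0 w = lshift 1 j]) => //.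
- exact: measurableI.
- by apply: (etrans (initial j)); rewrite pj0.
Qed.

End total_probability.

Section conditional_probability.
Context {R : realType} {d : measure_display} {Omega : measurableType d}.
Variable P : probability Omega R.

Lemma cond_prob_setT B : (P B != 0)%E -> measurable B -> cond_prob P setT B = 1.
Proof.
move=> PB0 mB; rewrite /cond_prob setTI divff// fine_eq0//.
exact: fin_num_measure.
Qed.

Lemma cond_probC E B : (P B != 0)%E -> measurable E -> measurable B ->
  cond_prob P (~` E) B = 1 - cond_prob P E B.
Proof.
move=> PB0 mE mB; rewrite /cond_prob.
have fB : P B \is a fin_num by exact: fin_num_measure.
have fB0 : fine (P B) != 0 by rewrite fine_eq0.
have mEB : measurable (E `&` B) by exact: measurableI.
have -> : P (~` E `&` B) = (P B - P (E `&` B))%E.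
  rewrite setIC -setDE measureD//; first by rewrite setIC.
  by rewrite -ge0_fin_numE.
by rewrite fineB ?fin_num_measure// mulrBl divff.
Qed.

Lemma cond_survival (p : nat) (T : 'M[R]_p) (J : R -> Omega -> 'I_(p + 1)) :
  is_markov_jump_process P J (absorbing_intensity T) ->
  exists2 A : R -> 'M[R]_p, is_substochastic_semigroup A T &
    forall (t : R) j, 0 <= t -> P [set w | J 0 w = lshift 1 j] != 0%E ->
      cond_prob P [set w | J t w != absorbing] [set w | J 0 w = lshift 1 j]
      = survival A (delta_mx 0 j) t.
Proof.
move=> HJ; have [Q HQ Hcond] := mjp_markov HJ.
exists (transient_block Q); first exact: transient_block_semigroup.
move=> t j t0 Pj; rewrite row_sum (transient_block_sum HQ)//.
have sT := @sigma_process_setT R d Omega _ J `[0, 0].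
have := Hcond 0 t setT (lshift 1 j) absorbing (lexx 0) t0 sT.
rewrite setTI add0r => <-//; rewrite -cond_probC//; last 2 first.
- exact: (mjp_measurable HJ).
- exact: (mjp_measurable HJ).
by congr cond_prob; apply/seteqP; split => w /= /eqP.
Qed.

End conditional_probability.

(** * Joint tails of the absorption times *)

Section mPH_construction.
Context {R : realType} {m p : nat}.
Variables (pi : 'rV[R]_p) (T : 'I_m -> 'M[R]_p).
Context {d : measure_display} {Omega : measurableType d}.
Variables (P : probability Omega R) (J : 'I_m -> R -> Omega -> 'I_(p + 1)).
Variable J0 : Omega -> 'I_(p + 1).
Hypothesis pi_prob : is_probability_vector pi.
Hypothesis HJ : is_mPH_construction pi T P J J0.

(** Measurability of [J0] is inherited from a process at time 0, hence the index [i]. *)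
Let mJ (i : 'I_m) s : measurable [set w | J0 w = s].
Proof.
rewrite (_ : [set w | J0 w = s] = [set w | J i 0 w = s]).
  exact: (mjp_measurable (mPH_markov HJ i)).
by apply/seteqP; split => w /=; rewrite (mPH_start HJ).
Qed.

Let late i t := [set w | (t%:E < absorption_time (fun s => J i s w))%E].
Let alive i t := [set w | J i t w != absorbing].

Let mlate i t : 0 <= t -> measurable (late i t).
Proof. exact: (measurable_absorption_time_gt (mPH_markov HJ i)). Qed.

Let malive i t : 0 <= t -> measurable (alive i t).
Proof. exact: (measurable_neq_absorbing (mPH_markov HJ i)). Qed.

(** Each [late] event lies in its [alive] event with null difference. Events on absorption times are
    thus traded for events on states at fixed times, where the Markov property and conditional
    independence apply. *)
Lemma absorption_times_gt k l s t : 0 <= s -> 0 <= t ->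
  P (late k s `&` late l t) = P (alive k s `&` alive l t).
Proof.
move=> s0 t0.
have mL : measurable (late k s `&` late l t).
  by apply: measurableI; exact: mlate.
have mA : measurable (alive k s `&` alive l t).
  by apply: measurableI; exact: malive.
have sub : late k s `&` late l t `<=` alive k s `&` alive l t.
  by apply: setISS; exact: (absorption_time_gt_sub (mPH_markov HJ _)).
rewrite [RHS](measureDI _ mA mL) (setIidr sub) [X in (X + _)%E](_ : _ = 0%E).
  by rewrite add0e.
apply: measure_negligible; first exact: measurableD.
apply: (@negligibleS _ _ _ _
    ((alive k s `\` late k s) `|` (alive l t `\` late l t))).
  by move=> w [[ak al] /not_andP[lk|ll]]; [left|right].
by apply: negligibleU; exact: (absorption_time_gt_negligible (mPH_markov HJ _)).
Qed.

Let sigma_alive i t : 0 <= t -> sigma_process (J i) `[0, +oo[ (alive i t).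
Proof.
move=> t0; rewrite (_ : alive i t = ~` [set w | J i t w = absorbing]).
  apply: (@sigma_algebraC Omega); apply: sub_sigma_algebra.
  by exists t, absorbing; split => //=; rewrite in_itv/= t0.
by apply/seteqP; split => w /= /eqP.
Qed.

Lemma mPH_construction_tails : exists2 A : 'I_m -> R -> 'M[R]_p,
  forall k, is_substochastic_semigroup (A k) (T k) &
  (forall k t, 0 <= t -> P (late k t) = (survival (A k) pi t)%:E) /\
  (forall k l s t, k != l -> 0 <= s -> 0 <= t ->
    P (late k s `&` late l t) =
    (\sum_j pi 0 j * survival (A k) (delta_mx 0 j) s
                   * survival (A l) (delta_mx 0 j) t)%:E).
Proof.
have /boolp.choice[A HA] : forall k, exists A : R -> 'M[R]_p,
    is_substochastic_semigroup A (T k) /\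
    forall (t : R) j, 0 <= t -> (P [set w | J0 w = lshift 1 j] != 0)%E ->
      cond_prob P (alive k t) [set w | J0 w = lshift 1 j]
      = survival A (delta_mx 0 j) t.
  move=> k; have [A HA1 HA2] := cond_survival (mPH_markov HJ k).
  exists A; split => // t j t0; have := HA2 t j t0.
  rewrite (_ : [set w | J k 0 w = lshift 1 j] = [set w | J0 w = lshift 1 j])//.
  by apply/seteqP; split => w /=; rewrite (mPH_start HJ).
exists A => [k|]; first by case: (HA k).
have tp (k : 'I_m) := total_probability (mJ k) pi_prob (mPH_initial HJ).
split => [k t t0|k l s t kl s0 t0].
  rewrite -[late k t]setIid absorption_times_gt// setIid tp//; last first.
    exact: malive.
  congr EFin; rewrite survivalE; apply: eq_bigr => j _; rewrite -row_sum.
  have [->|pj0] := eqVneq (pi 0 j) 0; first by rewrite !mul0r.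
  by rewrite (proj2 (HA k))// (mPH_initial HJ).
rewrite absorption_times_gt// tp//; last by apply: measurableI; exact: malive.
congr EFin; apply: eq_bigr => j _; rewrite -mulrA.
have [->|pj0] := eqVneq (pi 0 j) 0; first by rewrite !mul0r.
have Pj : (P [set w | J0 w = lshift 1 j] != 0)%E by rewrite (mPH_initial HJ).
congr (_ * _).
(* Conditional independence concerns whole families of events, so the indices other than [k] and [l]
   are filled with [setT], of conditional probability 1. *)
pose E i : set Omega :=
  if i == k then alive k s else if i == l then alive l t else setT.
have EE : \bigcap_i E i = alive k s `&` alive l t.
  apply/seteqP; split => w.
    move=> Ew; split.
      by have := Ew k I; rewrite /E eqxx.
    by have := Ew l I; rewrite /E eqxx eq_sym (negPf kl).
  move=> [wk wl] i _; rewrite /E; have [_//|_] := eqVneq i k.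
  by have [_|] := eqVneq i l.
rewrite -EE (mPH_independent HJ Pj).
  rewrite (bigD1 k)//= (bigD1 l)/=; last by rewrite eq_sym.
  rewrite {1 2}/E eqxx eq_sym (negPf kl) eqxx !(proj2 (HA _))//.
  rewrite big1 ?mulr1// => i /andP[ik il].
  by rewrite /E (negPf ik) (negPf il) cond_prob_setT//; exact: mJ.
move=> i; rewrite /E; have [->|_] := eqVneq i k; first exact: sigma_alive.
by have [->|_] := eqVneq i l; [exact: sigma_alive|exact: sigma_process_setT].
Qed.

End mPH_construction.

(** Equality of laws carries the tails from the space of the processes to that of [X]. There,
    nonnegativity holds only up to a null set. *)
Lemma mPH_tails (R : realType) (m p : nat)
    (d : measure_display) (Omega : measurableType d) (P : probability Omega R)
    (X : 'I_m -> {RV P >-> R}) (pi : 'rV[R]_p) (T : 'I_m -> 'M[R]_p) :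
  mPH X pi T ->
  exists2 A : 'I_m -> R -> 'M[R]_p,
  forall k, is_substochastic_semigroup (A k) (T k) &
  [/\ forall k, P [set w | X k w < 0] = 0%E,
      forall k t, 0 <= t -> P [set w | t < X k w] = (survival (A k) pi t)%:E &
      forall k l s t, k != l -> 0 <= s -> 0 <= t ->
        P ([set w | s < X k w] `&` [set w | t < X l w]) =
        (\sum_j pi 0 j * survival (A k) (delta_mx 0 j) s
                       * survival (A l) (delta_mx 0 j) t)%:E].
Proof.
move=> [pi_prob _ [d1 [Om1 [P1 [J [J0 [HJ law]]]]]]].
have [A HA [tail1 tail2]] := mPH_construction_tails pi_prob HJ.
exists A => //.
have mtnth k (i : interval (\bar R)) :
    measurable [set x : m.-tuple (\bar R) | tnth x k \in i].
  rewrite -[X in measurable X]setTI.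
  exact: (@measurable_tnth _ (\bar R) m k measurableT _ (emeasurable_itv i)).
have mgt k (t : R) :
    measurable [set x : m.-tuple (\bar R) | (t%:E < tnth x k)%E].
  have := mtnth k `]t%:E, +oo[.
  by congr measurable; apply/seteqP; split => x /=; rewrite in_itv/= andbT.
split.
- move=> k; have := law _ (mtnth k `]-oo, 0%E[); rewrite /pushforward.
  rewrite (_ : _ @^-1` _ = [set w | X k w < 0]); last first.
    by apply/seteqP; split => w /=; rewrite tnth_mktuple in_itv/= lte_fin.
  move=> ->; rewrite (_ : _ @^-1` _ = set0) ?measure0//.
  apply/seteqP; split => w //=.
  by rewrite tnth_mktuple in_itv/= ltNge absorption_time_ge0.
- move=> k t t0; rewrite -tail1//.
  have := law _ (mgt k t); rewrite /pushforward.
  rewrite (_ : _ @^-1` _ = [set w | t < X k w]); last first.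
    by apply/seteqP; split => w /=; rewrite tnth_mktuple lte_fin.
  move=> ->; congr (P1 _).
  by apply/seteqP; split => w /=; rewrite tnth_mktuple.
- move=> k l s t kl s0 t0; rewrite -tail2//.
  have := law _ (measurableI _ _ (mgt k s) (mgt l t)); rewrite /pushforward.
  rewrite (_ : _ @^-1` _ =
      [set w | s < X k w] `&` [set w | t < X l w]); last first.
    by apply/seteqP; split => w /=; rewrite !tnth_mktuple !lte_fin.
  move=> ->; congr (P1 _).
  by apply/seteqP; split => w /=; rewrite !tnth_mktuple.
Qed.

(** * Moments *)

Section tail_moments.
Context {R : realType} {d : measure_display} {Omega : measurableType d}.
Variable P : probability Omega R.
Local Open Scope ereal_scope.
Local Notation mu := (@lebesgue_measure R).

Lemma ge0_expectation_tail (f : Omega -> R) :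
  measurable_fun setT f -> (forall w, (0 <= f w)%R) ->
  'E_P[f] = \int[mu]_(r in `[0%R, +oo[) P [set w | (r < f w)%R].
Proof.
move=> mf f0; pose F : {mfun Omega >-> R} := mfun_Sub (mem_set mf).
rewrite -[LHS]/('E_P[F]) ge0_expectation_ccdf//.
apply: eq_integral => r _; rewrite /ccdf /distribution /pushforward.
by congr (P _); apply/seteqP; split => w /=; rewrite in_itv/= andbT.
Qed.

Lemma measurable_lt_cst (f : Omega -> R) (r : R) : measurable_fun setT f ->
  measurable [set w | (r < f w)%R].
Proof.
move=> mf; rewrite -[X in measurable X]setTI.
have := mf measurableT _ (measurable_itv `]r, +oo[).
by congr measurable; congr setI; apply/seteqP; split => w /=;
  rewrite in_itv/= andbT.
Qed.

(** Writing [f w] as the length of the interval from 0 to [f w] and exchanging integrals by Tonelli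
    leaves, for each [s], the expectation of [g] times the indicator of [s < f]; the tail formula
    for one variable then applies to it. *)
Lemma ge0_expectationM_tail (f g : Omega -> R) :
  measurable_fun setT f -> measurable_fun setT g ->
  (forall w, (0 <= f w)%R) -> (forall w, (0 <= g w)%R) ->
  'E_P[f * g] = \int[mu]_(s in `[0%R, +oo[) \int[mu]_(t in `[0%R, +oo[)
    P ([set w | (s < f w)%R] `&` [set w | (t < g w)%R]).
Proof.
move=> mf mg f0 g0; pose GR := measurableTypeR R.
rewrite unlock.
transitivity (\int[P]_w \int[mu]_s (g w * \1_`[0%R, f w[ s)%:E).
  apply: eq_integral => w _ /=.
  under eq_integral do rewrite EFinM.
  rewrite ge0_integralZl//; last by rewrite lee_fin.
  - rewrite integral_indic//= setIT lebesgue_measure_itv/= lte_fin.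
    have [f_gt0|f_le0] := ltP 0%R (f w); first by rewrite sube0 mulrC EFinM.
    have fw0 : f w = 0%R by apply/le_anti; rewrite f_le0 f0.
    have -> : (f * g)%R w = 0%R by apply: etrans (mul0r (g w)); rewrite -fw0.
    by rewrite mule0.
  - by apply/measurable_EFinP; exact: measurable_indic.
rewrite (fubini_tonelli (fun q : Omega * GR =>
  (g q.1 * \1_`[0%R, f q.1[ q.2)%:E))//=; last 2 first.
- apply/measurable_EFinP; apply: measurable_funM.
    exact: measurableT_comp mg measurable_fst.
  apply: measurable_indic.
  pose le0 (q : Omega * GR) := (0 <= q.2)%R.
  pose lef (q : Omega * GR) := (q.2 < f q.1)%R.
  rewrite [X in measurable X](_ : _ =
      le0 @^-1` [set true] `&` lef @^-1` [set true]); last first.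
    by apply/seteqP; split => q; rewrite /= in_itv/= => /andP.
  apply: measurableI.
  + have : measurable_fun setT le0 by exact: measurable_fun_ler.
    by move=> /(_ measurableT [set true]); rewrite setTI; exact.
  + have : measurable_fun setT lef.
      apply: measurable_fun_ltr => //.
      exact: measurableT_comp mf measurable_fst.
    by move=> /(_ measurableT [set true]); rewrite setTI; exact.
- by move=> q; rewrite lee_fin mulr_ge0.
rewrite [RHS]integral_mkcond; apply: eq_integral => s _; rewrite patchE.
rewrite mem_setE in_itv/= andbT; case: leP => s0; last first.
  apply: integral0_eq => w _; rewrite indicE memNset ?mulr0//=.
  by rewrite in_itv/= leNgt s0.
have mlt := measurable_lt_cst s mf.
transitivity 'E_P[g \* \1_[set w | (s < f w)%R]].
  rewrite unlock; apply: eq_integral => w _ /=; congr (_ * _)%:E.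
  rewrite !indicE; congr ((nat_of_bool _)%:R); rewrite mem_setE in_itv/= s0/=.
  by apply/idP/idP; rewrite inE.
rewrite ge0_expectation_tail; last 2 first.
- by apply: measurable_funM => //; exact: measurable_indic.
- by move=> w /=; rewrite mulr_ge0.
apply: eq_integral => t; rewrite inE/= in_itv/= andbT => t0.
congr (P _); apply/seteqP; split => w /=; rewrite indicE.
  have [/set_mem/= sf|_] := boolP (w \in _); first by rewrite mulr1.
  by rewrite mulr0 ltNge t0.
by move=> [sf tg]; rewrite mem_set// mulr1.
Qed.

(** Moments are computed on a nonnegative version [g], where tail formulas hold; finiteness of its
    expectation also yields integrability of [f]. *)
Lemma ae_expectation (f g : Omega -> R) (c : R) :
  measurable_fun setT f -> measurable_fun setT g ->
  (forall w, (0 <= g w)%R) -> {ae P, forall w, f w = g w} ->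
  'E_P[g] = c%:E -> f \in Lfun P 1 /\ 'E_P[f] = c%:E.
Proof.
move=> mf mg g0 fg Eg; split; last first.
  rewrite -Eg unlock; apply: ae_eq_integral => //; try exact/measurable_EFinP.
  by apply: filterS fg => w fgw _; rewrite /= fgw.
apply/Lfun1_integrable/integrableP; split; first exact/measurable_EFinP.
rewrite (_ : integral _ _ _ = c%:E) ?ltry// -Eg unlock.
apply: ae_eq_integral => //.
- by apply/measurable_EFinP; exact: measurableT_comp.
- exact/measurable_EFinP.
- by apply: filterS fg => w fgw _ /=; rewrite fgw ger0_norm.
Qed.

End tail_moments.

(** * Covariance and standard deviation from moments *)

Section pearson.
Context {R : realType} {d : measure_display} {Omega : measurableType d}.
Variable P : probability Omega R.

Lemma covariance_from_moments (X Y : Omega -> R) (a b c : R) :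
  X \in Lfun P 1 -> Y \in Lfun P 1 -> (X * Y)%R \in Lfun P 1 ->
  'E_P[X]%E = a%:E -> 'E_P[Y]%E = b%:E -> 'E_P[X * Y]%E = c%:E ->
  covariance P X Y = (c - a * b)%:E.
Proof.
by move=> lX lY lXY EX EY EXY; rewrite covarianceE// EX EY EXY EFinB EFinM.
Qed.

Lemma standard_deviationE (X : Omega -> R) (v : R) :
  'V_P[X]%E = v%:E -> standard_deviation P X = (Num.sqrt v)%:E.
Proof.
move=> Vv; rewrite /standard_deviation Vv poweR_EFin powR12_sqrt//.
by rewrite -lee_fin -Vv variance_ge0.
Qed.
End pearson.

Lemma state_entry_sum (R : realType) (p : nat) (u : 'rV[R]_p) (M : 'M[R]_p) :
  (u *m M *m (const_mx 1 : 'cV[R]_p)) 0 0 = \sum_j u 0 j * state_entry j M.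
Proof.
rewrite -mulmxA mxE; apply: eq_bigr => j _; congr (_ * _).
by rewrite /state_entry -mulmxA -rowE [RHS]mxE.
Qed.

(** * First, second and mixed moments of mPH vectors *)

Section mPH_moments.
Context {R : realType} {m p : nat}.
Context {d : measure_display} {Omega : measurableType d}.
Variables (P : probability Omega R) (X : 'I_m -> {RV P >-> R}).
Variables (pi : 'rV[R]_p) (T : 'I_m -> 'M[R]_p).
Hypothesis hX : mPH X pi T.
Local Notation mean k := (\sum_j pi 0 j * state_entry j (invmx (- T k))).

(** Since [X k] is nonnegative only almost surely, its positive part replaces it; the tails at
    nonnegative levels are unchanged. *)
Let Xp k : Omega -> R := fun w => Num.max (X k w) 0.

Let mXp k : measurable_fun setT (Xp k).
Proof. by apply: measurable_maxr. Qed.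

Let Xp_ge0 k w : 0 <= Xp k w.
Proof. by rewrite le_max lexx orbT. Qed.

Let Xp_gt k (t : R) : 0 <= t -> [set w | t < Xp k w] = [set w | t < X k w].
Proof.
move=> t0; apply/seteqP; split => w /=; rewrite lt_max.
  by case/orP => // /lt_geF; rewrite t0.
by move=> ->.
Qed.

(** The entry is the integral of a nonnegative survival function, namely the mean absorption time
    from state [j]. *)
Lemma state_entry_inv_ge0 (A : R -> 'M[R]_p) k j :
  is_substochastic_semigroup A (T k) -> T k \in unitmx ->
  0 <= state_entry j (invmx (- T k)).
Proof.
move=> HA uT; rewrite -lee_fin /state_entry -(integral_survival HA uT).
  apply: integral_ge0 => x; rewrite /= in_itv/= andbT => x0.
  by rewrite lee_fin (survival_ge0 HA)// => i; rewrite mxE.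
by move=> i; rewrite mxE.
Qed.

Lemma mPH_moments :
  [/\ forall k, (X k : Omega -> R) \in Lfun P 1 /\ 'E_P[X k]%E = (mean k)%:E,
   forall k, (X k * X k : Omega -> R)%R \in Lfun P 1 /\
     'E_P[X k * X k]%E = (2 * \sum_j pi 0 j *
       state_entry j (invmx (- T k) *m invmx (- T k)))%:E &
   forall k l, k != l -> (X k * X l : Omega -> R)%R \in Lfun P 1 /\
     'E_P[X k * X l]%E = (\sum_j pi 0 j * state_entry j (invmx (- T k))
                                    * state_entry j (invmx (- T l)))%:E].
Proof.
have [A HA [neg tail1 tail2]] := mPH_tails hX.
case: hX => -[pi0 _] hT _.
have uT k : T k \in unitmx by case: (hT k).
have mX k : measurable_fun setT (X k) by [].
have aeX k : {ae P, forall w, X k w = Xp k w}.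
  exists [set w | X k w < 0]; split => //.
    rewrite (_ : [set w | _] = ~` [set w | 0 <= X k w]).
      apply: measurableC; rewrite -[X in measurable X]setTI.
      have := mX k measurableT _ (measurable_itv `[0, +oo[).
      by congr measurable; congr setI; apply/seteqP; split => w /=;
        rewrite in_itv/= andbT.
    by apply/seteqP; split => w /=; rewrite ltNge => /negP.
  move=> w /= H; rewrite ltNge; apply/negP => X0; apply: H.
  by rewrite /Xp max_l.
have aeXX k l : {ae P, forall w, (X k * X l)%R w = (Xp k * Xp l)%R w}.
  by apply: filterS2 (aeX k) (aeX l) => w Hk Hl; congr (_ * _).
split=> [k|k|k l kl].
- apply: (ae_expectation (g := Xp k)) => //.
  rewrite ge0_expectation_tail// -state_entry_sum.
  rewrite -(integral_survival (HA k) (uT k) pi0).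
  apply: eq_integral => t; rewrite inE/= in_itv/= andbT => t0.
  by rewrite Xp_gt// tail1.
- apply: (ae_expectation (g := (Xp k * Xp k)%R)) => //.
  + exact: (measurable_funM (mXp k) (mXp k)).
  + by move=> w; exact: mulr_ge0.
  rewrite ge0_expectation_tail; last 2 first.
  + exact: (measurable_funM (mXp k) (mXp k)).
  + by move=> w; exact: mulr_ge0.
  rewrite -state_entry_sum -(integral_survival_sqrt (HA k) (uT k) pi0).
  apply: eq_integral => t; rewrite inE/= in_itv/= andbT => t0.
  rewrite -tail1 ?sqrtr_ge0// -Xp_gt ?sqrtr_ge0//.
  congr (P _); apply/seteqP; split => w /= tX.
    have {}tX : t < Xp k w ^+ 2 by [].
    rewrite -(ger0_norm (Xp_ge0 k w)) -sqrtr_sqr ltr_sqrt//.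
    exact: le_lt_trans tX.
  suff: t < Xp k w ^+ 2 by [].
  by rewrite -(sqr_sqrtr t0) ltrXn2r ?nnegrE ?sqrtr_ge0.
- apply: (ae_expectation (g := (Xp k * Xp l)%R)) => //.
  + exact: (measurable_funM (mXp k) (mXp l)).
  + by move=> w; exact: mulr_ge0.
  rewrite ge0_expectationM_tail//.
  (* The factor of [l] is stored in the weights [v], so that the outer integral becomes that of a
     single survival function for [A k]. *)
  pose v : 'rV[R]_p := \row_j (pi 0 j * state_entry j (invmx (- T l))).
  have v0 j : 0 <= v 0 j.
    by rewrite mxE mulr_ge0//; exact: state_entry_inv_ge0 (HA l) (uT l).
  have -> : \sum_j pi 0 j * state_entry j (invmx (- T k))
                          * state_entry j (invmx (- T l))
      = \sum_j v 0 j * state_entry j (invmx (- T k)).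
    by apply: eq_bigr => j _; rewrite mxE mulrAC.
  rewrite -state_entry_sum -(integral_survival (HA k) (uT k) v0).
  apply: eq_integral => s; rewrite inE/= in_itv/= andbT => s0.
  (* For fixed [s] the roles are exchanged: the survival of the process [k] is stored in the weights
     [u], and the inner integral is that of a survival function for [A l]. *)
  pose u : 'rV[R]_p := \row_j (pi 0 j * survival (A k) (delta_mx 0 j) s).
  have u0 j : 0 <= u 0 j.
    rewrite mxE mulr_ge0// (survival_ge0 (HA k))// => i.
    by rewrite mxE.
  have -> : survival (A k) v s = \sum_j u 0 j * state_entry j (invmx (- T l)).
    rewrite survivalE; apply: eq_bigr => j _.
    by rewrite !mxE -row_sum mulrAC.
  rewrite -state_entry_sum -(integral_survival (HA l) (uT l) u0).
  apply: eq_integral => t; rewrite inE/= in_itv/= andbT => t0.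
  rewrite !Xp_gt// tail2//; congr EFin; rewrite survivalE.
  by apply: eq_bigr => j _; rewrite -row_sum [u 0 j]mxE.
Qed.

End mPH_moments.

Theorem corollary2p7 (R : realType) (d p : nat)
    (disp : measure_display) (Omega : measurableType disp)
    (P : probability Omega R) (X : 'I_d -> {RV P >-> R})
    (pi : 'rV[R]_p) (T : 'I_d -> 'M[R]_p) (hX : mPH X pi T) :
  let mu k := \sum_(j < p) pi 0 j * state_entry j (invmx (- T k)) in
  let sigma k :=
    Num.sqrt
      (2 * (\sum_(j < p)
              pi 0 j * state_entry j (invmx (- T k) *m invmx (- T k)))
       - mu k ^+ 2) in
  (forall k : 'I_d, standard_deviation P (X k) = (sigma k)%:E) /\
  (forall k l : 'I_d, k != l ->
    pearson_correlation P (X k) (X l)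
    = ((\sum_(j < p)
          pi 0 j * state_entry j (invmx (- T k))
                 * state_entry j (invmx (- T l)))
       - mu k * mu l)
      / (sigma k * sigma l)).
Proof.
move=> mu sigma; have [E1 E2 E11] := mPH_moments hX.
have sd k : standard_deviation P (X k) = (sigma k)%:E.
  apply: standard_deviationE; have [lX EX] := E1 k; have [lXX EXX] := E2 k.
  (* The variance is by definition the covariance of [X k] with itself. *)
  by rewrite expr2; exact: covariance_from_moments.
split=> // k l kl; rewrite /pearson_correlation !sd.
have [lX EX] := E1 k; have [lY EY] := E1 l; have [lXY EXY] := E11 k l kl.
by rewrite (covariance_from_moments lX lY lXY EX EY EXY).
Qed.
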